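(* Let $L$ be a signature for classical first-order logic, regarded also as a signature for continuous logic by assigning to every function and predicate symbol the modulus of uniform continuity $\Delta(\epsilon)=\epsilon$, and let $M$ be a classical $L$-structure, regarded also as a metric $L$-structure by equipping it with the discrete metric. Then the following are equivalent: (i) $M$ is classically pseudofinite; (ii) $M$ is pseudofinite; (iii) $M$ is strongly pseudofinite; (iv) $M$ is pseudocompact; (v) $M$ is strongly pseudocompact.
   Context: Continuous first-order logic for metric structures (Ben Yaacov–Berenstein–Henson–Usvyatsov) is used, with a $1$-bounded one-sorted signature. Metric $L$-structures are complete metric spaces of diameter at most $1$, with interpretations of constant symbols, function symbols, and $[0,1]$-valued predicate symbols. Each function or predicate symbol $s$ has a modulus of uniform continuity $\Delta_s$: $d(a,b)<\Delta_s(\epsilon)$ implies $d(f(a),f(b))\le\epsilon$ (for $s=f$ a function symbol), respectively $|P(a)-P(b)|\le\epsilon$ (for $s=P$ a predicate symbol); tuples carry the maximum metric. Connectives are all continuous functions $[0,1]^n\to[0,1]$, quantifiers are $\sup$ and $\inf$. The value of a sentence $\sigma$ in $M$ is $\sigma^M\in[0,1]$, and the value $0$ stands for ''true''. A classical $L$-structure $M$ is a metric $L$-structure via the discrete metric ($d(a,b)=1$ if $a\neq b$), with $P^M(a)=0$ if $P$ holds of $a$ and $P^M(a)=1$ otherwise. A metric $L$-structure is finite (resp. compact) if its underlying metric space is. (Finite metric $L$-structures need not come from classical structures.) Definitions. $M$ is classically pseudofinite if every classical first-order $L$-sentence true in $M$ is true in some finite classical $L$-structure. A metric $L$-structure $M$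 is pseudofinite (resp. pseudocompact) if $\sigma^M=0$ for every continuous $L$-sentence $\sigma$ such that $\sigma^A=0$ for all finite (resp. compact) metric $L$-structures $A$. $M$ is strongly pseudofinite (resp. strongly pseudocompact) if for every continuous $L$-sentence $\sigma$ with $\sigma^M=0$ there is a finite (resp. compact) metric $L$-structure $A$ with $\sigma^A=0$. *)

(* Defs.v *)
From HB Require Import structures.
From mathcomp Require Import all_boot all_order all_algebra.
From mathcomp Require Import all_classical all_reals interval_inference.
From mathcomp Require Import topology normedtype.

Set Implicit Arguments.
Unset Strict Implicit.
Unset Printing Implicit Defensive.

Import Order.TTheory GRing.Theory Num.Theory.
Import numFieldNormedType.Exports.

Local Open Scope classical_set_scope.
Local Open Scope ring_scope.

Record signature := Signature {
  const_symb : Type;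
  func_symb : Type;
  pred_symb : Type;
  func_arity : func_symb -> nat;
  pred_arity : pred_symb -> nat
}.

(* Terms and formulas are indexed by the type V of their free variables. Under
   a quantifier the variables are [option V]: [None] is the bound variable, and
   a sentence is a formula over [void]. *)
Inductive term (L : signature) (V : Type) : Type :=
| Var of V
| Cst of const_symb L
| App (f : func_symb L) of ('I_(func_arity f) -> term L V).

Arguments Var {L V} _.
Arguments Cst {L V} _.
Arguments App {L V} f _.

Inductive fo_formula (L : signature) (V : Type) : Type :=
| FEq of term L V & term L V
| FPred (P : pred_symb L) of ('I_(pred_arity P) -> term L V)
| FNot of fo_formula L V
| FAnd of fo_formula L V & fo_formula L V
| FOr of fo_formula L V & fo_formula L V
| FImp of fo_formula L V & fo_formula L V
| FForall of fo_formula L (option V)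
| FExists of fo_formula L (option V).

Arguments FPred {L V} P _.

Definition fo_sentence (L : signature) := fo_formula L void.

Record fo_structure (L : signature) := FoStructure {
  fo_carrier :> Type;
  fo_nonempty : exists x : fo_carrier, True;
  fo_const : const_symb L -> fo_carrier;
  fo_func : forall f : func_symb L,
    ('I_(func_arity f) -> fo_carrier) -> fo_carrier;
  fo_pred : forall P : pred_symb L, ('I_(pred_arity P) -> fo_carrier) -> Prop
}.

Definition extend (V T : Type) (e : V -> T) (a : T) : option V -> T := oapp e a.

Fixpoint fo_term_value (L : signature) (M : fo_structure L) (V : Type)
    (e : V -> M) (t : term L V) : M :=
  match t with
  | Var x => e x
  | Cst c => fo_const M c
  | App f ts => fo_func (fun i => fo_term_value e (ts i))
  end.

Fixpoint fo_holds (L : signature) (M : fo_structure L) (V : Type)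
    (phi : fo_formula L V) : (V -> M) -> Prop :=
  match phi with
  | FEq s t => fun e => fo_term_value e s = fo_term_value e t
  | FPred P ts => fun e => fo_pred (fun i => fo_term_value e (ts i))
  | FNot p => fun e => ~ fo_holds p e
  | FAnd p q => fun e => fo_holds p e /\ fo_holds q e
  | FOr p q => fun e => fo_holds p e \/ fo_holds q e
  | FImp p q => fun e => fo_holds p e -> fo_holds q e
  | FForall p => fun e => forall a : M, fo_holds p (extend e a)
  | FExists p => fun e => exists a : M, fo_holds p (extend e a)
  end.

Definition fo_true (L : signature) (M : fo_structure L) (s : fo_sentence L) :=
  fo_holds s (of_void M).

Definition classically_pseudofinite (L : signature) (M : fo_structure L) :=
  forall s : fo_sentence L, fo_true M s ->
    exists A : fo_structure L, finite_set [set: A] /\ fo_true A s.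

Record modulus (R : realType) := Modulus {
  modulus_fun :> R -> R;
  modulusP : forall e, 0 < e <= 1 -> 0 < modulus_fun e <= 1
}.

Record metric_signature (R : realType) := MetricSignature {
  symbols :> signature;
  func_modulus : func_symb symbols -> modulus R;
  pred_modulus : pred_symb symbols -> modulus R
}.

Definition tuple_dist (R : realType) (T : metricType R) (n : nat)
    (a b : 'I_n -> T) : R :=
  \big[Num.max/0]_(i < n) mdist (a i) (b i).

Record metric_structure (R : realType) (L : metric_signature R) :=
  MetricStructure {
  ms_carrier :> metricType R;
  ms_nonempty : exists x : ms_carrier, True;
  ms_diameter : forall x y : ms_carrier, mdist x y <= 1;
  ms_complete : forall F : set_system ms_carrier,
    ProperFilter F -> cauchy F -> exists x : ms_carrier, F --> x;
  ms_const : const_symb L -> ms_carrier;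
  ms_func : forall f : func_symb L,
    ('I_(func_arity f) -> ms_carrier) -> ms_carrier;
  ms_pred : forall P : pred_symb L, ('I_(pred_arity P) -> ms_carrier) -> R;
  ms_pred_bounds : forall (P : pred_symb L) a, 0 <= @ms_pred P a <= 1;
  ms_func_modulus : forall (f : func_symb L) e, 0 < e <= 1 -> forall a b,
    tuple_dist a b < func_modulus f e ->
    mdist (@ms_func f a) (@ms_func f b) <= e;
  ms_pred_modulus : forall (P : pred_symb L) e, 0 < e <= 1 -> forall a b,
    tuple_dist a b < pred_modulus P e ->
    `|@ms_pred P a - @ms_pred P b| <= e
}.

Definition unit_cube (R : realType) (n : nat) : set 'rV[R]_n :=
  [set x | forall i, 0 <= x ord0 i <= 1].

(* An n-ary connective is a continuous map [0,1]^n -> [0,1]; the values of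
   [conn_fun] outside of the cube are never used. *)
Record connective (R : realType) (n : nat) := Connective {
  conn_fun :> 'rV[R]_n -> R;
  conn_bounds : forall x, unit_cube x -> 0 <= conn_fun x <= 1;
  conn_continuous : {within @unit_cube R n, continuous conn_fun}
}.

Inductive formula (R : realType) (L : signature) (V : Type) : Type :=
| CDist of term L V & term L V
| CPred (P : pred_symb L) of ('I_(pred_arity P) -> term L V)
| CConn (n : nat) of connective R n & ('I_n -> formula R L V)
| CSup of formula R L (option V)
| CInf of formula R L (option V).

Arguments CDist {R L V} _ _.
Arguments CPred {R L V} P _.
Arguments CConn {R L V} n _ _.

Definition sentence (R : realType) (L : signature) := formula R L void.

Fixpoint term_value (R : realType) (L : metric_signature R)
    (M : metric_structure L) (V : Type) (e : V -> M) (t : term L V) : M :=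
  match t with
  | Var x => e x
  | Cst c => ms_const M c
  | App f ts => ms_func (fun i => term_value e (ts i))
  end.

(* The carrier is nonempty and all values lie in [0,1], so [sup] and [inf] are
   taken over nonempty bounded sets. *)
Fixpoint formula_value (R : realType) (L : metric_signature R)
    (M : metric_structure L) (V : Type) (phi : formula R L V) :
    (V -> M) -> R :=
  match phi with
  | CDist s t => fun e => mdist (term_value e s) (term_value e t)
  | CPred P ts => fun e => ms_pred (fun i => term_value e (ts i))
  | CConn n u ps => fun e => u (\row_(i < n) formula_value (ps i) e)
  | CSup p => fun e => sup [set formula_value p (extend e a) | a in [set: M]]
  | CInf p => fun e => inf [set formula_value p (extend e a) | a in [set: M]]
  end.

Definition sentence_value (R : realType) (L : metric_signature R)
    (M : metric_structure L) (s : sentence R L) : R :=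
  formula_value s (of_void M).

Section Pseudo.
Variables (R : realType) (L : metric_signature R).
Implicit Types (M A : metric_structure L) (s : sentence R L).

Definition finite_structure A := finite_set [set: A].

Definition compact_structure A := compact [set: A].

Definition pseudofinite M := forall s,
  (forall A, finite_structure A -> sentence_value A s = 0) ->
  sentence_value M s = 0.

Definition pseudocompact M := forall s,
  (forall A, compact_structure A -> sentence_value A s = 0) ->
  sentence_value M s = 0.

Definition strongly_pseudofinite M := forall s, sentence_value M s = 0 ->
  exists A, finite_structure A /\ sentence_value A s = 0.

Definition strongly_pseudocompact M := forall s, sentence_value M s = 0 ->
  exists A, compact_structure A /\ sentence_value A s = 0.

End Pseudo.

Definition id_modulus (R : realType) : modulus R :=
  @Modulus R (fun e => e) (fun e he => he).

Definition to_metric_signature (R : realType) (L : signature) :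
    metric_signature R :=
  @MetricSignature R L (fun=> id_modulus R) (fun=> id_modulus R).

(* The alias mentions R because the metric is R-valued. It is not the library's
   [discrete_topology]: the balls of the latter are singletons for every
   radius, so no distance with values in {0, 1} induces them. *)
Definition discrete_space (R : realType) (T : Type) : Type := T.

HB.instance Definition _ (R : realType) (T : Type) :=
  gen_eqMixin (discrete_space R T).
HB.instance Definition _ (R : realType) (T : Type) :=
  gen_choiceMixin (discrete_space R T).

Section DiscreteMetric.
Variables (R : realType) (T : Type).
Implicit Types x y z : discrete_space R T.

Definition discrete_dist x y : R := if x == y then 0 else 1.

Let distxx x : discrete_dist x x = 0.
Proof. by rewrite /discrete_dist eqxx. Qed.

Let dist_positivity x y : discrete_dist x y = 0 -> x = y.
Proof.
by rewrite /discrete_dist; case: eqP => // _ /eqP; rewrite oner_eq0.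
Qed.

Let dist_sym x y : discrete_dist x y = discrete_dist y x.
Proof. by rewrite /discrete_dist eq_sym. Qed.

Let dist_triangle y x z :
  discrete_dist x z <= discrete_dist x y + discrete_dist y z.
Proof.
rewrite /discrete_dist; have [->|nxz] := eqVneq x z.
  by rewrite addr_ge0//; case: ifP.
have [<-|nxy] := eqVneq x y; first by rewrite (negPf nxz) add0r.
by rewrite lerDl; case: ifP.
Qed.

HB.instance Definition _ := isMetric.Build R (discrete_space R T)
  distxx dist_positivity dist_sym dist_triangle.

Lemma discrete_distE x y : mdist x y = if x == y then 0 else 1.
Proof. by []. Qed.

Lemma discrete_dist_le1 x y : mdist x y <= 1.
Proof. by rewrite discrete_distE; case: ifP. Qed.

Lemma discrete_dist_lt1 x y : mdist x y < 1 -> x = y.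
Proof. by rewrite discrete_distE; case: eqP => // _; rewrite ltxx. Qed.

Lemma discrete_tuple_dist n (a b : 'I_n -> discrete_space R T) :
  tuple_dist a b < 1 -> a = b.
Proof.
move=> ab; apply/funext => i; apply: discrete_dist_lt1.
apply: le_lt_trans ab; exact: (le_bigmax _ (fun i => mdist (a i) (b i)) i).
Qed.

Lemma discrete_complete (F : set_system (discrete_space R T)) :
  ProperFilter F -> cauchy F -> exists x : discrete_space R T, F --> x.
Proof.
move=> FF cF.
have ent1 : entourage [set xy : discrete_space R T * discrete_space R T |
    ball xy.1 1 xy.2] by exact: (entourage_ball _ (PosNum ltr01)).
have [[P Q]/= [FP FQ] PQ] := cF _ ent1.
have [x Px] := filter_ex FP.
exists x => B /nbhs_singleton Bx.
apply: filterS FQ => y Qy.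
have := PQ (x, y) (conj Px Qy); rewrite /= ballEmdist /= => /discrete_dist_lt1.
by move=> <-.
Qed.

End DiscreteMetric.

Section DiscreteStructure.
Variables (R : realType) (L : signature) (M : fo_structure L).

Let D := discrete_space R M.
Let LR := to_metric_signature R L.

Definition discrete_pred (P : pred_symb LR) (a : 'I_(pred_arity P) -> D) : R :=
  if `[< @fo_pred L M P a >] then 0 else 1.

Lemma discrete_pred_bounds (P : pred_symb LR) (a : 'I_(pred_arity P) -> D) :
  0 <= discrete_pred a <= 1.
Proof. by rewrite /discrete_pred; case: ifP; rewrite ?lexx ?ler01. Qed.

Lemma discrete_func_modulus (f : func_symb LR) (e : R) : 0 < e <= 1 ->
  forall a b : 'I_(func_arity f) -> D, tuple_dist a b < func_modulus f e ->
  mdist (@fo_func L M f a : D) (@fo_func L M f b : D) <= e.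
Proof.
move=> /andP[e0 e1] a b /lt_le_trans/(_ e1)/discrete_tuple_dist ->.
by rewrite mdistxx ltW.
Qed.

Lemma discrete_pred_modulus (P : pred_symb LR) (e : R) : 0 < e <= 1 ->
  forall a b : 'I_(pred_arity P) -> D, tuple_dist a b < pred_modulus P e ->
  `|discrete_pred a - discrete_pred b| <= e.
Proof.
move=> /andP[e0 e1] a b /lt_le_trans/(_ e1)/discrete_tuple_dist ->.
by rewrite subrr normr0 ltW.
Qed.

Definition discrete_structure : metric_structure LR :=
  @MetricStructure R LR D (fo_nonempty M)
    (@discrete_dist_le1 R M) (@discrete_complete R M)
    (@fo_const L M) (@fo_func L M) discrete_pred
    discrete_pred_bounds discrete_func_modulus discrete_pred_modulus.

End DiscreteStructure.

(* Main.v *)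
Require Import Defs.
From mathcomp Require Import all_boot all_order all_algebra.
From mathcomp Require Import all_classical all_reals.
From mathcomp Require Import topology normedtype lra.

(* Over discrete structures, the value of a continuous sentence is a function of
   the truth values of finitely many classical sentences, uniformly in the
   structure; a finite classical model of the conjunction describing these truth
   values in [M] gives the sentence exactly its value in [M]. Hence (i) implies
   (ii) and (iii).

   Conversely, let [s] be a classical sentence true in [M]. Replacing connectives
   and quantifiers by their [0,1]-valued analogues, and taking the maximum with
   sentences saying that the metric and the atomic subformulas of [s] take values
   near {0, 1}, gives a continuous sentence with value 0 in [M]. If its value in a
   compact structure [A] is at most 1/8, then "at distance at most 1/8" is an
   equivalence relation on [A] with finitely many classes, and the moduli make
   the symbols of the signature descend to a finite classical quotient, in which
   [s] holds. So if [s] has no finite model, the value is above 1/8 in all compact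
   structures, which contradicts (v), and (iv) after truncation. *)

Set Implicit Arguments.
Unset Strict Implicit.
Unset Printing Implicit Defensive.

Import Order.TTheory GRing.Theory Num.Theory.
Import numFieldNormedType.Exports.

Local Open Scope classical_set_scope.
Local Open Scope ring_scope.

(** * Continuous sentences over discrete structures *)

Section FiniteTruthData.
Variables (R : realType) (L : signature).

(** Serves as the empty conjunction, since the classical syntax has no constant for truth. *)
Definition fo_top (V : Type) : fo_formula L V :=
  FForall (FEq (Var None) (Var None)).

Definition state_formula (V : Type) (I : finType) (chi : I -> fo_formula L V)
    (b : {ffun I -> bool}) : fo_formula L V :=
  foldr (@FAnd L V) (fo_top V)
    [seq if b i then chi i else FNot (chi i) | i <- enum I].

Lemma state_formulaP (V : Type) (I : finType) (chi : I -> fo_formula L V)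
    (b : {ffun I -> bool}) (A : fo_structure L) (e : V -> A) :
  fo_holds (state_formula chi b) e <->
  [set i | fo_holds (chi i) e] = [set i | b i].
Proof.
(* The pointwise form over [enum I] lets the conjunction be handled by induction on that list. *)
have -> : ([set i | fo_holds (chi i) e] = [set i | b i]) <->
    forall i, i \in enum I -> (fo_holds (chi i) e <-> b i).
  split => [E i _|E]; last first.
    by apply/seteqP; split=> i /=; apply E; rewrite mem_enum.
  by have : [set i | fo_holds (chi i) e] i <-> [set i | b i] i by rewrite E.
rewrite /state_formula; elim: (enum I) => [|i s IH] /=; first by split.
rewrite IH; split=> [[hi hs] j|h].
- rewrite inE => /predU1P[->|/hs//].
  by case: (b i) hi => /= hi; split.
- split=> [|j js]; last by apply: h; rewrite inE js orbT.
  have := h i (mem_head _ _).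
  by case: (b i) => /= -[h1 h2]; [exact: h2|move=> /h1].
Qed.

Lemma discrete_term_value (A : fo_structure L) (V : Type) (e : V -> A)
    (t : term L V) :
  term_value (M := discrete_structure R A) e t = fo_term_value e t.
Proof.
by elim: t => //= f ts IH; congr fo_func; apply/funext => i; rewrite IH.
Qed.

(** Both components are fixed before any structure is chosen; this uniformity lets a truth pattern
    be carried from one structure to a finite one. *)
Definition truth_table (V : Type) :=
  {I : finType & ((I -> fo_formula L V) * (set I -> R))%type}.

Definition truth_table_value (V : Type) (d : truth_table V)
    (A : fo_structure L) (e : V -> A) : R :=
  (projT2 d).2 [set i | fo_holds ((projT2 d).1 i) e].

Lemma set_of_state (I : finType) (S : set I) :
  S = [set i | [ffun i => `[<S i>]] i].
Proof. by apply/seteqP; split=> i /=; rewrite ffunE => /asboolP. Qed.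

(* A table for [phi (extend e a)] indexed by [I] yields one for the quantified
   formula indexed by the subsets of [I]: which of them occur as the truth
   pattern of some [a] is expressed by existential formulas, and this
   determines the set of values of [phi], hence its supremum and infimum. *)
Lemma truth_table_quantifier (V : Type) (phi : formula R L (option V))
    (d : truth_table (option V)) (Q : set R -> R) :
  (forall (A : fo_structure L) (e : option V -> A),
    formula_value (M := discrete_structure R A) phi e =
    truth_table_value d e) ->
  exists d' : truth_table V, forall (A : fo_structure L) (e : V -> A),
    Q [set formula_value (M := discrete_structure R A) phi (extend e a) |
       a in [set: A]] = truth_table_value d' e.
Proof.
case: d => I [chi F] dE.
exists (existT _ ({ffun I -> bool} : finType)
  (fun b => FExists (state_formula chi b),
   fun S => Q [set F [set i | (b : {ffun I -> bool}) i] | b in S])) => A e.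
rewrite /truth_table_value /=; congr Q; apply/seteqP; split=> r /=.
- move=> [a _ <-]; exists [ffun i => `[<fo_holds (chi i) (extend e a)>]].
    exists a; apply/state_formulaP.
    exact: set_of_state [set i | fo_holds (chi i) (extend e a)].
  rewrite dE /truth_table_value /=; congr F; apply/esym.
  exact: set_of_state [set i | fo_holds (chi i) (extend e a)].
- move=> [b [a /state_formulaP ab] <-]; exists a => //.
  by rewrite dE /truth_table_value /= ab.
Qed.

Lemma formula_truth_table (V : Type) (phi : formula R L V) :
  exists d : truth_table V, forall (A : fo_structure L) (e : V -> A),
    formula_value (M := discrete_structure R A) phi e = truth_table_value d e.
Proof.
have atom (W : Type) (p : fo_formula L W) : exists d : truth_table W,
    forall (A : fo_structure L) (e : W -> A),
    (if `[<fo_holds p e>] then 0 else 1) = truth_table_value d e.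
  by exists (existT _ (unit : finType)
    (fun=> p, fun S => if `[<S tt>] then 0 else 1)).
elim: phi => {V} [V s t|V P ts|V n u ps IH|V p [d dE]|V p [d dE]].
- have [d dE] := atom _ (FEq s t); exists d => A e; rewrite -dE /=.
  by rewrite !discrete_term_value discrete_distE.
- have [d dE] := atom _ (FPred P ts); exists d => A e; rewrite -dE /=.
  by rewrite /discrete_pred; under eq_fun do rewrite discrete_term_value.
- have [d dE] := choice IH.
  (* The index type is the disjoint union of those of the subformulas, so each subformula recovers
     its own pattern as a slice of [S]. *)
  exists (existT _ ({i : 'I_n & projT1 (d i)} : finType)
    (fun k => (projT2 (d (tag k))).1 (tagged k),
     fun S => u (\row_i (projT2 (d i)).2
       [set k | S (Tagged (fun j => projT1 (d j) : Type) k)]))) => A e.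
  rewrite /truth_table_value /=; congr (u _).
  by apply/rowP => i; rewrite !mxE dE.
- exact: truth_table_quantifier dE.
- exact: truth_table_quantifier dE.
Qed.

Lemma classically_pseudofinite_sentence_value (M : fo_structure L)
    (s : sentence R L) :
  classically_pseudofinite M ->
  exists A : fo_structure L, finite_set [set: A] /\
    sentence_value (discrete_structure R A) s =
    sentence_value (discrete_structure R M) s.
Proof.
move=> pM; have [d dE] := formula_truth_table s.
case: d dE => I [chi F] dE.
pose S := [set i | fo_holds (chi i) (of_void M)].
have /pM[A [fA /state_formulaP AS]] :
    fo_true M (state_formula chi [ffun i => `[<S i>]]).
  by apply/state_formulaP; exact: set_of_state S.
exists A; split=> //; rewrite /sentence_value !dE /truth_table_value /= AS.
by rewrite -set_of_state.
Qed.

End FiniteTruthData.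

(** * Values in the unit interval, suprema and infima *)

Section Bounds.
Variables (R : realType) (L : metric_signature R) (A : metric_structure L).

(** Keeps [sup] and [inf] away from their default values on unbounded sets. *)
Lemma formula_value_bounds (V : Type) (phi : formula R L V) (e : V -> A) :
  0 <= formula_value phi e <= 1.
Proof.
elim: phi e => {V} [V s t|V P ts|V n u ps IH|V p IH|V p IH] e /=.
- by rewrite mdist_ge0 ms_diameter.
- exact: ms_pred_bounds.
- by apply: conn_bounds => i; rewrite mxE.
- have [a _] := ms_nonempty A; apply/andP; split.
    apply: le_trans (_ : formula_value p (extend e a) <= _).
      by case/andP: (IH (extend e a)).
    apply: ub_le_sup; last by exists a.
    by exists 1 => _ [b _ <-]; case/andP: (IH (extend e b)).
  apply: ge_sup => [|_ [b _ <-]]; last by case/andP: (IH (extend e b)).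
  by exists (formula_value p (extend e a)), a.
- have [a _] := ms_nonempty A; apply/andP; split.
    apply: lb_le_inf => [|_ [b _ <-]]; last by case/andP: (IH (extend e b)).
    by exists (formula_value p (extend e a)), a.
  apply: le_trans (_ : formula_value p (extend e a) <= _); last first.
    by case/andP: (IH (extend e a)).
  apply: ge_inf; last by exists a.
  by exists 0 => _ [b _ <-]; case/andP: (IH (extend e b)).
Qed.

Lemma CSup_leP (V : Type) (phi : formula R L (option V)) (e : V -> A) (x : R) :
  formula_value (CSup phi) e <= x <->
  forall a, formula_value phi (extend e a) <= x.
Proof.
split=> [h a|h] /=.
- apply: le_trans h; apply: ub_le_sup; last by exists a.
  by exists 1 => _ [b _ <-]; case/andP: (formula_value_bounds phi (extend e b)).
- have [a _] := ms_nonempty A; apply: ge_sup => [|_ [b _ <-]//].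
  by exists (formula_value phi (extend e a)), a.
Qed.

Lemma le_CSup (V : Type) (phi : formula R L (option V)) (e : V -> A) a :
  formula_value phi (extend e a) <= formula_value (CSup phi) e.
Proof. exact: (CSup_leP phi e _).1. Qed.

Lemma CInf_geP (V : Type) (phi : formula R L (option V)) (e : V -> A) (x : R) :
  x <= formula_value (CInf phi) e <->
  forall a, x <= formula_value phi (extend e a).
Proof.
split=> [h a|h] /=.
- apply: le_trans h _; apply: ge_inf; last by exists a.
  by exists 0 => _ [b _ <-]; case/andP: (formula_value_bounds phi (extend e b)).
- have [a _] := ms_nonempty A; apply: lb_le_inf => [|_ [b _ <-]//].
  by exists (formula_value phi (extend e a)), a.
Qed.

Lemma CInf_le (V : Type) (phi : formula R L (option V)) (e : V -> A) a :
  formula_value (CInf phi) e <= formula_value phi (extend e a).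
Proof. exact: (CInf_geP phi e _).1. Qed.

End Bounds.

(** * Negation, maximum, minimum and truncated difference *)

Section Connectives.
Variables (R : realType).

Lemma neg_conn_bounds (x : 'rV[R]_1) : unit_cube x -> 0 <= 1 - x ord0 ord0 <= 1.
Proof. by move=> /(_ ord0) /andP[? ?]; apply/andP; split; lra. Qed.

Lemma neg_conn_continuous :
  {within @unit_cube R 1, continuous (fun x : 'rV[R]_1 => 1 - x ord0 ord0)}.
Proof.
apply: continuous_subspaceT => x.
apply: (@continuousB R R^o 'rV[R]_1 (fun=> 1)
  (fun x : 'rV[R]_1 => x ord0 ord0) x); first exact: cst_continuous.
exact: coord_continuous.
Qed.

Definition neg_conn : connective R 1 :=
  Connective neg_conn_bounds neg_conn_continuous.

Lemma max_conn_bounds (x : 'rV[R]_2) : unit_cube x ->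
  0 <= Num.max (x ord0 ord0) (x ord0 ord_max) <= 1.
Proof. by move=> c; rewrite maxEle; case: ifP. Qed.

Lemma max_conn_continuous : {within @unit_cube R 2, continuous
  (fun x : 'rV[R]_2 => Num.max (x ord0 ord0) (x ord0 ord_max))}.
Proof.
apply: continuous_subspaceT => x.
by apply: (@continuous_max R _ (fun x : 'rV[R]_2 => x ord0 ord0)
  (fun x : 'rV[R]_2 => x ord0 ord_max)); exact: coord_continuous.
Qed.

Definition max_conn : connective R 2 :=
  Connective max_conn_bounds max_conn_continuous.

Lemma gap_conn_bounds (x : 'rV[R]_1) : unit_cube x ->
  0 <= Num.max 0 (8^-1 - x ord0 ord0) <= 1.
Proof.
move=> /(_ ord0) /andP[? ?]; rewrite le_max lexx/= ge_max ler01 /=; lra.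
Qed.

Lemma gap_conn_continuous : {within @unit_cube R 1, continuous
  (fun x : 'rV[R]_1 => Num.max 0 (8^-1 - x ord0 ord0))}.
Proof.
apply: continuous_subspaceT => x.
apply: (@continuous_max R _ (fun=> 0)
  (fun x : 'rV[R]_1 => 8^-1 - x ord0 ord0)); first exact: cst_continuous.
apply: (@continuousB R R^o 'rV[R]_1 (fun=> 8^-1)
  (fun x : 'rV[R]_1 => x ord0 ord0) x); first exact: cst_continuous.
exact: coord_continuous.
Qed.

Definition gap_conn : connective R 1 :=
  Connective gap_conn_bounds gap_conn_continuous.

Variables (L : metric_signature R) (V : Type).
Implicit Types p q : formula R L V.

Definition CNeg p := CConn 1 neg_conn (fun=> p).
Definition CMax p q :=
  CConn 2 max_conn (fun i => if i == ord0 then p else q).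
Definition CMin p q := CNeg (CMax (CNeg p) (CNeg q)).
(** Vanishes exactly when the value of [p] is at least 1/8: this turns a uniform lower bound into a
    value 0, which is what pseudocompactness speaks of. *)
Definition CGap p := CConn 1 gap_conn (fun=> p).

Variables (A : metric_structure L) (e : V -> A).

Lemma CNegE p : formula_value (CNeg p) e = 1 - formula_value p e.
Proof. by rewrite /= mxE. Qed.

Lemma CMaxE p q :
  formula_value (CMax p q) e = Num.max (formula_value p e) (formula_value q e).
Proof. by rewrite /= !mxE. Qed.

Lemma CMinE p q :
  formula_value (CMin p q) e = Num.min (formula_value p e) (formula_value q e).
Proof. by rewrite CNegE CMaxE !CNegE maxEle minEle; do 2 case: ifP; lra. Qed.

Lemma CGapE p :
  formula_value (CGap p) e = Num.max 0 (8^-1 - formula_value p e).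
Proof. by rewrite /= mxE. Qed.

End Connectives.

(** * From classical to continuous sentences *)

Section Translation.
Variables (R : realType) (L : signature).
Let LR := to_metric_signature R L.

Fixpoint translate (V : Type) (phi : fo_formula L V) : formula R LR V :=
  match phi with
  | FEq s t => @CDist R LR V s t
  | FPred P ts => @CPred R LR V P ts
  | FNot p => CNeg (translate p)
  | FAnd p q => CMax (translate p) (translate q)
  | FOr p q => CMin (translate p) (translate q)
  | FImp p q => CMin (CNeg (translate p)) (translate q)
  | FForall p => CSup (translate p)
  | FExists p => CInf (translate p)
  end.

(* The value of [crispness phi] bounds the distance to {0, 1} of the values of
   all the atomic subformulas of [phi]. *)
Fixpoint crispness (V : Type) (phi : fo_formula L V) : formula R LR V :=
  match phi with
  | FEq s t => let a := @CDist R LR V s t in CMin a (CNeg a)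
  | FPred P ts => let a := @CPred R LR V P ts in CMin a (CNeg a)
  | FNot p => crispness p
  | FAnd p q | FOr p q | FImp p q => CMax (crispness p) (crispness q)
  | FForall p | FExists p => CSup (crispness p)
  end.

Definition near_truth (eps : R) (Q : Prop) (v : R) :=
  (Q -> v <= eps) /\ (~ Q -> 1 - eps <= v).

(** [approx_pred] is conditional because one sentence controls only the finitely many predicates
    that occur in it, whereas it can control the whole metric. *)
Record approximation (eps : R) (A : metric_structure LR) (B : fo_structure L)
    (pi : A -> B) : Prop := Approximation {
  approx_surj : forall b, exists a, pi a = b;
  approx_dist : forall x y, near_truth eps (pi x = pi y) (mdist x y);
  approx_const : forall c, pi (ms_const A c) = fo_const B c;
  approx_func : forall (f : func_symb L) (a : 'I_(func_arity f) -> A),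
    pi (@ms_func R LR A f a) = fo_func (pi \o a);
  approx_pred : forall (P : pred_symb L) (a : 'I_(pred_arity P) -> A),
    Num.min (@ms_pred R LR A P a) (1 - @ms_pred R LR A P a) <= eps ->
    near_truth eps (fo_pred (pi \o a)) (@ms_pred R LR A P a) }.

Lemma comp_extend (V T U : Type) (g : T -> U) (e : V -> T) a :
  g \o extend e a = extend (g \o e) (g a).
Proof. by apply/funext; case. Qed.

Section Approximation.
Variables (eps : R) (A : metric_structure LR) (B : fo_structure L).
Variables (pi : A -> B).
Hypothesis piP : approximation eps pi.

Lemma approx_term (V : Type) (e : V -> A) (t : term L V) :
  pi (@term_value R LR A V e t) = fo_term_value (pi \o e) t.
Proof.
elim: t => //= [c|f ts IH]; first exact: approx_const piP c.
rewrite (approx_func piP); congr fo_func.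
by apply/funext => i /=; rewrite IH.
Qed.

(** The error does not grow: maxima, minima, suprema and infima preserve the bounds [eps] and
    [1 - eps], and negation exchanges them. Surjectivity of [pi] lets quantifiers over [B] be tested
    on [A]. *)
Lemma translate_near_truth (V : Type) (phi : fo_formula L V) (e : V -> A) :
  formula_value (crispness phi) e <= eps ->
  near_truth eps (fo_holds phi (pi \o e)) (formula_value (translate phi) e).
Proof.
elim: phi e => {V} [V s t|V P ts|V p IH|V p IHp q IHq|V p IHp q IHq
  |V p IHp q IHq|V p IH|V p IH] e.
- by move=> _; rewrite [fo_holds _ _]/= -!approx_term; exact: approx_dist.
- rewrite [crispness _]/= CMinE CNegE => /(approx_pred piP).
  suff -> : fo_holds (FPred P ts) (pi \o e) =
    fo_pred (pi \o (fun i => @term_value R LR A V e (ts i))) by [].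
  by congr fo_pred; apply/funext => i; rewrite /= approx_term.
- move=> /IH[t f]; rewrite [translate _]/= CNegE; split=> /= h.
    by have := f h; lra.
  by have [/t|//] := pselect (fo_holds p (pi \o e)); lra.
- rewrite [crispness _]/= CMaxE ge_max => /andP[/IHp[tp fp] /IHq[tq fq]].
  rewrite [translate _]/= CMaxE; split=> /=.
    by move=> [/tp ? /tq ?]; rewrite ge_max; apply/andP.
  move=> /not_andP; rewrite le_max => -[/fp->//|/fq->]; exact: orbT.
- rewrite [crispness _]/= CMaxE ge_max => /andP[/IHp[tp fp] /IHq[tq fq]].
  rewrite [translate _]/= CMinE; split=> /=.
    by rewrite ge_min => -[/tp->//|/tq->]; exact: orbT.
  by move=> /not_orP[/fp ? /fq ?]; rewrite le_min; apply/andP.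
- rewrite [crispness _]/= CMaxE ge_max => /andP[/IHp[tp fp] /IHq[tq fq]].
  rewrite [translate _]/= CMinE CNegE; split=> /=.
    rewrite ge_min => pq.
    have [/pq/tq->|/fp h] := pselect (fo_holds p (pi \o e)).
      exact: orbT.
    by apply/orP; left; lra.
  move=> /not_implyP[/tp ? /fq ?]; rewrite le_min; apply/andP; split=> //; lra.
- move=> /CSup_leP cr; rewrite [translate _]/=; split=> [/= h|].
    apply/CSup_leP => a; apply: (IH _ (cr a)).1.
    by rewrite comp_extend.
  move=> /existsNP[b]; have [a <-] := approx_surj piP b.
  rewrite -comp_extend => /(IH _ (cr a)).2 /le_trans; apply; exact: le_CSup.
- move=> /CSup_leP cr; rewrite [translate _]/=; split=> [[b]|].
    have [a <-] := approx_surj piP b; rewrite -comp_extend.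
    by move=> /(IH _ (cr a)).1; apply: le_trans; exact: CInf_le.
  move=> /forallNP h; apply/CInf_geP => a; apply: (IH _ (cr a)).2.
  by rewrite comp_extend.
Qed.

Lemma translate_true (s : fo_sentence L) : eps < 2^-1 ->
  formula_value (crispness s) (of_void A) <= eps ->
  formula_value (translate s) (of_void A) <= eps -> fo_true B s.
Proof.
move=> eps2 /translate_near_truth[_ f] s_le; apply: contrapT => ns.
suff /f : ~ fo_holds s (pi \o of_void A) by lra.
by rewrite (_ : _ \o _ = of_void B) //; apply/funext; case.
Qed.

End Approximation.

(** With error 0, the induction made for compact structures gives exact values in discrete ones. *)
Lemma discrete_approximation (M : fo_structure L) :
  @approximation 0 (discrete_structure R M) M id.
Proof.
split=> //.
- by move=> b; exists b.
- move=> x y; rewrite discrete_distE; split=> [->|xy]; first by rewrite eqxx.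
  by case: ifP => [/eqP /xy//|_]; rewrite subr0.
- move=> P a _; rewrite /= /discrete_pred.
  by split=> h; [rewrite asboolT|rewrite asboolF // subr0].
Qed.

Lemma discrete_crispness (M : fo_structure L) (V : Type) (phi : fo_formula L V)
    (e : V -> discrete_structure R M) :
  formula_value (crispness phi) e <= 0.
Proof.
elim: phi e => {V} [V s t|V P ts|V p IH|V p IHp q IHq|V p IHp q IHq
  |V p IHp q IHq|V p IH|V p IH] e //; rewrite [crispness _]/=;
  try by rewrite CMaxE ge_max IHp IHq.
- rewrite CMinE CNegE /= discrete_distE ge_min.
  by case: ifP; rewrite ?lexx // subrr lexx orbT.
- rewrite CMinE CNegE /= /discrete_pred ge_min.
  by case: ifP; rewrite ?lexx // subrr lexx orbT.
- by apply/CSup_leP.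
- by apply/CSup_leP.
Qed.

(* Only the crispness of this sentence matters: it bounds the distance of the
   whole metric to {0, 1}. *)
Definition all_equal : fo_sentence L :=
  FForall (FForall (FEq (Var None) (Var (Some None)))).

Definition truth_test (s : fo_sentence L) : sentence R LR :=
  CMax (translate s) (CMax (crispness s) (crispness all_equal)).

Lemma discrete_truth_test (M : fo_structure L) (s : fo_sentence L) :
  fo_true M s -> sentence_value (discrete_structure R M) (truth_test s) = 0.
Proof.
move=> Ms; apply/eqP; rewrite /sentence_value eq_le.
have /andP[-> _] := formula_value_bounds (A := discrete_structure R M)
  (truth_test s) (of_void M).
rewrite andbT !CMaxE !ge_max !discrete_crispness !andbT.
by have [+ _] := translate_near_truth (discrete_approximation M)
  (discrete_crispness s (of_void M)); apply.
Qed.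

End Translation.

(* Near-covering is applied to the filter generated by the finite subsets of [T]
   ordered by inclusion; cover-compactness would require a pointed space. *)
Lemma compact_locally_constant_finite (X : topologicalType) (T : Type)
    (f : X -> T) :
  compact [set: X] -> (forall x, \forall y \near x, f y = f x) ->
  finite_set (range f).
Proof.
move=> /compact_near_coveringP cX fx.
pose F : set_system (set T) := fun P =>
  exists2 D0, finite_set D0 & forall D, D0 `<=` D -> P D.
have FF : Filter F.
  split=> [|P Q [D1 fD1 D1P] [D2 fD2 D2Q]|P Q PQ [D0 fD0 D0P]].
  - by exists set0; [exact: finite_set0|].
  - exists (D1 `|` D2); first by rewrite finite_setU.
    move=> D D12; split; [apply: D1P|apply: D2Q] => t Dt.
      by apply: D12; left.
    by apply: D12; right.
  - by exists D0 => // D /D0P /PQ.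
(* Near [x] the only value is [f x], so every [D] containing it works there; near-covering then
   yields one finite [D0] containing all values. *)
have [x _|D0 fD0 /(_ D0 (@subset_refl _ _)) D0f] :=
    cX _ F (fun D x => D (f x)) FF.
  exists ([set y | f y = f x], [set D | D (f x)]) => /=.
    split; first exact: fx.
    by exists [set f x]; [exact: finite_set1|move=> D; apply].
  by move=> [y D] /= [->].
by apply: sub_finite_set fD0 => _ [x _ <-]; exact: D0f.
Qed.

(** * The finite classical quotient of a compact structure *)

Section Quotient.
Variables (R : realType) (L : signature).
Let LR := to_metric_signature R L.
Variables (A : metric_structure LR).
Hypothesis crispA : forall x y : A,
  Num.min (mdist x y) (1 - mdist x y) <= 8^-1.

Definition same_class : rel A := fun x y => mdist x y <= 8^-1.

(** Distances are at most 1/8 or at least 7/8, so any bound below 7/8 improves itself to 1/8.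
    Transitivity and the descent of functions rest on this. *)
Lemma lt_same_class x y : mdist x y < 1 - 8^-1 -> same_class x y.
Proof.
by have := crispA x y; rewrite ge_min /same_class => /orP[->//|]; lra.
Qed.

Lemma same_class_equiv : equiv_class_of same_class.
Proof.
split=> [x|x y|y x z].
- by rewrite /same_class mdistxx invr_ge0.
- by rewrite /same_class metric_sym.
- rewrite /same_class => xy yz; apply: lt_same_class.
  by have := metric_triangle x y z; lra.
Qed.

Let eqv := EquivRelPack same_class_equiv.
Let Q : Type := {eq_quot eqv}%qT.
Let cls (x : A) : Q := (\pi_({eq_quot eqv}) x)%qT.
Let rep (q : Q) : A := repr q.

Let clsP x y : cls x = cls y <-> same_class x y.
Proof. by split=> [/(eqmodP eqv)|/(eqmodP eqv)]. Qed.

Let repK q : cls (rep q) = q.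
Proof. exact: reprK. Qed.

(** The distance is in fact at most 1/8; the moduli ask for a strict bound, and 1/4 leaves room for
    it. *)
Lemma tuple_dist_rep n (a : 'I_n -> A) :
  tuple_dist a (rep \o (cls \o a)) < 4^-1.
Proof.
apply: bigmax_lt => [|i _]; first by rewrite invr_gt0.
by have /clsP := esym (repK (cls (a i))); rewrite /same_class /=; lra.
Qed.

Lemma quotient_nonempty : exists q : Q, True.
Proof. by have [a _] := ms_nonempty A; exists (cls a). Qed.

(** Symbols are evaluated at chosen representatives because predicates that are not crisp need not
    respect the classes. *)
Definition quotient : fo_structure L := @FoStructure L Q quotient_nonempty
  (fun c => cls (ms_const A c))
  (fun f q => cls (@ms_func R LR A f (rep \o q)))
  (fun P q => @ms_pred R LR A P (rep \o q) < 2^-1).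

Lemma quotient_approximation : @approximation R L 8^-1 A quotient cls.
Proof.
split=> //.
- by move=> q; exists (rep q).
- move=> x y; split=> [/clsP//|/clsP ne].
  by rewrite leNgt; apply/negP => /lt_same_class.
- move=> f a; apply/clsP; apply: lt_same_class.
  apply: le_lt_trans (_ : 4^-1 < _); last lra.
  by apply: ms_func_modulus (tuple_dist_rep a); apply/andP; split; lra.
- move=> P a.
  (* A crisp value moved by at most 1/4 ends at most 3/8 or at least 5/8, so it stays on its side of
     the threshold 1/2. *)
  have : `|@ms_pred R LR A P a - @ms_pred R LR A P (rep \o (cls \o a))| <= 4^-1.
    by apply: ms_pred_modulus (tuple_dist_rep a); apply/andP; split; lra.
  rewrite ler_norml ge_min => /andP[? ?] /orP cr.
  by split=> /= [lt2|/negP]; [case: cr; lra|rewrite -leNgt; case: cr; lra].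
Qed.

(** A class contains the ball of radius 1/8 about each of its points, so [cls] is locally
    constant. *)
Lemma quotient_finite : compact_structure A -> finite_set [set: quotient].
Proof.
move=> cA; apply: sub_finite_set (_ : finite_set (range cls)).
  by move=> q _; exists (rep q).
apply: compact_locally_constant_finite cA _ => x.
have : nbhs x (ball x (8^-1 : R)) by apply: nbhsx_ballx; rewrite invr_gt0.
apply: filterS => y; rewrite ballEmdist /= => /ltW xy.
by apply/esym/clsP.
Qed.

End Quotient.

(** * The implications between the five notions *)

Section Equivalence.
Variables (R : realType) (L : signature) (M : fo_structure L).
Let LR := to_metric_signature R L.

Lemma truth_test_finite_model (A : metric_structure LR) (s : fo_sentence L) :
  compact_structure A -> sentence_value A (truth_test R s) <= 8^-1 ->
  exists B : fo_structure L, finite_set [set: B] /\ fo_true B s.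
Proof.
move=> cA; rewrite /sentence_value !CMaxE !ge_max => /and3P[As crs].
move=> /CSup_leP h.
have crA (x y : A) : Num.min (mdist x y) (1 - mdist x y) <= 8^-1.
  by have /CSup_leP/(_ x) := h y; rewrite CMinE CNegE.
exists (quotient crA); split; first exact: quotient_finite.
apply: (translate_true (quotient_approximation crA) _ crs As); lra.
Qed.

Lemma pseudocompact_classically_pseudofinite :
  pseudocompact (discrete_structure R M) -> classically_pseudofinite M.
Proof.
move=> pM s Ms; apply: contrapT => noB.
have := pM (CGap (truth_test R s)); rewrite /sentence_value CGapE.
rewrite -/(sentence_value _ _) discrete_truth_test // subr0 => gap0.
(* If [s] has no finite model, the test exceeds 1/8 in every compact structure and its gap vanishes
   there, while the gap in [M] is 1/8. *)
suff /gap0 : forall A : metric_structure LR, compact_structure A ->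
    formula_value (CGap (truth_test R s)) (of_void A) = 0.
  by rewrite max_r; lra.
move=> A cA; rewrite CGapE max_l // subr_le0 leNgt.
by apply/negP => /ltW /(truth_test_finite_model cA).
Qed.

Lemma strongly_pseudocompact_classically_pseudofinite :
  strongly_pseudocompact (discrete_structure R M) -> classically_pseudofinite M.
Proof.
move=> pM s /(discrete_truth_test R) /pM[A [cA A0]].
by apply: truth_test_finite_model cA _; rewrite A0 invr_ge0.
Qed.

Lemma classically_pseudofinite_pseudofinite :
  classically_pseudofinite M -> pseudofinite (discrete_structure R M).
Proof.
move=> pM s s0.
have [A [fA <-]] := classically_pseudofinite_sentence_value s pM.
exact: s0.
Qed.

Lemma classically_pseudofinite_strongly_pseudofinite :
  classically_pseudofinite M -> strongly_pseudofinite (discrete_structure R M).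
Proof.
move=> pM s s0.
have [A [fA As]] := classically_pseudofinite_sentence_value s pM.
by exists (discrete_structure R A); rewrite As.
Qed.

End Equivalence.

Lemma finite_structure_compact (R : realType) (L : metric_signature R)
    (A : metric_structure L) : finite_structure A -> compact_structure A.
Proof. exact: finite_compact. Qed.

Lemma pseudofinite_pseudocompact (R : realType) (L : metric_signature R)
    (M : metric_structure L) : pseudofinite M -> pseudocompact M.
Proof.
by move=> pM s s0; apply: pM => A /finite_structure_compact; exact: s0.
Qed.

Lemma strongly_pseudofinite_pseudocompact (R : realType)
    (L : metric_signature R) (M : metric_structure L) :
  strongly_pseudofinite M -> strongly_pseudocompact M.
Proof.
by move=> pM s /pM[A [/finite_structure_compact cA A0]]; exists A.
Qed.

Theorem theorem3p1 (R : realType) (L : signature) (M : fo_structure L) :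
  [<-> classically_pseudofinite M;
       pseudofinite (discrete_structure R M);
       strongly_pseudofinite (discrete_structure R M);
       pseudocompact (discrete_structure R M);
       strongly_pseudocompact (discrete_structure R M)].
Proof.
(* Each implication between two continuous notions passes through classical pseudofiniteness. *)
tfae.
- exact: classically_pseudofinite_pseudofinite.
- move=> /pseudofinite_pseudocompact /pseudocompact_classically_pseudofinite.
  exact: classically_pseudofinite_strongly_pseudofinite.
- move=> /strongly_pseudofinite_pseudocompact.
  move=> /strongly_pseudocompact_classically_pseudofinite pM.
  exact/pseudofinite_pseudocompact/classically_pseudofinite_pseudofinite.
- move=> /pseudocompact_classically_pseudofinite pM.
  apply: strongly_pseudofinite_pseudocompact.
  exact: classically_pseudofinite_strongly_pseudofinite.
- exact: strongly_pseudocompact_classically_pseudofinite.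
Qed.
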